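(* Let $(\Omega,\mathcal S,\mu)$ be a measure space, let $m\ge 1$, and for each $j\le m$ let $(M_j,\mathcal M_j,\nu_j)$ be a measure space together with a measurable function $p_j:\Omega\to M_j$. For any probability density $f$ on $\Omega$, let $f_{(p_j)}$ denote its $j$-th marginal, a probability density on $M_j$. Let $\{c_1,\dots,c_m\}$ be any set of $m$ nonnegative numbers. Then for any $D\in\mathbb R$ the following two assertions are equivalent: 1. For any $m$ nonnegative functions $f_j:M_j\to\mathbb R_+$, $j\le m$, $$\int_\Omega \prod_{j=1}^m f_j(p_j(x))\,d\mu(x)\le e^D\prod_{j=1}^m\left(\int_{M_j} f_j^{1/c_j}(t)\,d\nu_j(t)\right)^{c_j}.$$ 2. For every probability density $f$ on $(\Omega,\mathcal S,\mu)$ with finite entropy, $$\sum_{j=1}^m c_j\,S(f_{(p_j)})\le S(f)+D.$$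
   Context: A probability density on a measure space $(\Omega,\mathcal S,\mu)$ is a nonnegative integrable function $f$ with $\int_\Omega f\,d\mu=1$. It has finite entropy if $\int_\Omega f\ln(1+f)\,d\mu<\infty$, and its entropy is $S(f)=\int_\Omega f\ln f\,d\mu$ (note the sign convention). The entropy of a density on $(M_j,\nu_j)$ is defined in the same way with respect to $\nu_j$, so $S(f_{(p_j)})=\int_{M_j}f_{(p_j)}\ln f_{(p_j)}\,d\nu_j$. Marginals: $f_{(p_j)}$ is the probability density on $M_j$ (with respect to $\nu_j$) such that $\int_\Omega \phi(p_j(x))f(x)\,d\mu(x)=\int_{M_j}\phi(t)f_{(p_j)}(t)\,d\nu_j(t)$ for all bounded measurable functions $\phi$ on $M_j$; that is, $f_{(p_j)}\,d\nu_j$ is the push-forward of $f\,d\mu$ under $p_j$.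
   Formalization: The measure μ is assumed semifinite (the claim fails for one point of infinite mass); c_j = 0 is read as the L^∞ norm, 0·∞ as 0, and where the entropies are undefined or give ∞ − ∞ on the left of assertion 2, nothing is claimed. *)

(* Defs.v *)
From HB Require Import structures.
From mathcomp Require Import all_boot all_order all_algebra.
From mathcomp Require Import all_classical all_reals all_analysis.

Set Implicit Arguments.
Unset Strict Implicit.
Unset Printing Implicit Defensive.

Import Order.TTheory GRing.Theory Num.Theory.
Import numFieldNormedType.Exports.

Local Open Scope classical_set_scope.
Local Open Scope ring_scope.

Section Definitions.
Context (R : realType).

Section OneSpace.
Context (d : measure_display) (T : measurableType d).
Variable mu : {measure set T -> \bar R}.

(* Every sigma-finite measure is semifinite.  Without such a condition a
   measure may admit no probability density at all (e.g. one point of infinite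
   mass), and then any assertion about all densities is vacuous. *)
Definition semifinite :=
  forall A : set T, measurable A -> mu A = +oo%E ->
    exists B : set T, [/\ measurable B, B `<=` A & (0 < mu B < +oo)%E].

Definition prob_density (f : T -> R) :=
  [/\ forall x, 0 <= f x,
      mu.-integrable setT (EFin \o f)
    & (\int[mu]_x (f x)%:E = 1)%E].

Definition finite_entropy (f : T -> R) :=
  (\int[mu]_x (f x * ln (1 + f x))%:E < +oo)%E.

(* [ln 0 = 0] in the library, so the integrand is 0 where [f] vanishes.  The
   value is extended-real: it lies in [-oo, +oo[ when [f] has finite entropy,
   but the entropy of a marginal may also be +oo, or be undefined (positive and
   negative parts both of infinite integral).  In the last case, as in every
   undefined sum [+oo + -oo], the library's value is -oo. *)
Definition entropy (f : T -> R) : \bar R :=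
  (\int[mu]_x (f x * ln (f x))%:E)%E.

(* [(\int u^(1/c))^c] is the norm of [u >= 0] in L^(1/c), which for [c = 0] is
   the L^oo norm. *)
Definition pow_integral (c : R) (u : T -> R) : \bar R :=
  if c == 0 then ('N[mu]_+oo[EFin \o u])%E
  else ((\int[mu]_t (u t `^ c^-1)%:E) `^ c)%E.

End OneSpace.

(* [g] is the density with respect to [nu] of the image under [p] of the
   measure [f dmu]; such a [g] is unique up to [nu]-null sets. *)
Definition is_marginal (d d' : measure_display)
    (T : measurableType d) (M : measurableType d')
    (mu : {measure set T -> \bar R}) (nu : {measure set M -> \bar R})
    (p : T -> M) (f : T -> R) (g : M -> R) :=
  prob_density nu g /\
  forall phi : M -> R, measurable_fun setT phi ->
    (exists K : R, forall t, `|phi t| <= K) ->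
    (\int[mu]_x (phi (p x) * f x)%:E = \int[nu]_t (phi t * g t)%:E)%E.

End Definitions.

(* Main.v *)
(* Both implications rest on [ln s <= s - 1].  Given the multilinear inequality,
   apply it to the powers [g_j^(c_j)] of the marginals of [f] and integrate
   [f ln G <= f ln f + D f + e^-D G - f], where [G = \prod_j g_j^(c_j) o p_j].
   Conversely, let [F = \prod_j f_j o p_j] and let [f] be proportional to [F]
   on a set of finite measure where every [f_j o p_j] lies in [1/n, n].  Then
   [S(f)] is the sum of the integrals of [g_j ln f_j] minus [ln \int F], and
   each of these integrals is at most [c_j S(g_j) + ln |f_j|_(1/c_j)].  Since
   [mu] is semifinite, the whole set where the [f_j o p_j] lie in [1/n, n] has
   finite measure, and monotone convergence removes the truncation. *)
Require Import Defs.
From HB Require Import structures.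
From mathcomp Require Import all_boot all_order all_algebra.
From mathcomp Require Import all_classical all_reals all_analysis.
From mathcomp Require Import measurable_realfun ess_sup_inf lra ring.

Import Order.TTheory GRing.Theory Num.Theory.
Import numFieldNormedType.Exports.

Local Open Scope classical_set_scope.
Local Open Scope ring_scope.

(** * Monotonicity, integrability and scaling for extended-real integrals *)

Section Integral.
Context {R : realType} {d : measure_display} {T : measurableType d}.
Context {mu : {measure set T -> \bar R}}.
Local Open Scope ereal_scope.

(* No integrability is needed because an undefined integral is -oo. *)
Lemma ae_le_integral (h u : T -> R) : measurable_fun setT h ->
  measurable_fun setT u -> {ae mu, forall x, (h x <= u x)%R} ->
  \int[mu]_x (h x)%:E <= \int[mu]_x (u x)%:E.
Proof.
move=> /measurable_EFinP mh /measurable_EFinP mu_ hu.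
rewrite integralE [leRHS]integralE; apply: leeB.
  apply: ae_ge0_le_integral => //; [exact: measurable_funepos..|].
  apply: filterS hu => x hux _; rewrite !funeposE.
  by rewrite le_max2 ?lee_fin.
apply: ae_ge0_le_integral => //; [exact: measurable_funeneg..|].
apply: filterS hu => x hux _; rewrite !funenegE.
by rewrite le_max2 ?leeN2 ?lee_fin.
Qed.

(** A finite value forces both parts of [u] to have finite integral, because [+oo - +oo] evaluates
    to [-oo]; integrability can thus be read off the value of the integral. *)
Lemma integrable_fin_numP (u : T -> R) : measurable_fun setT u ->
  \int[mu]_x (u x)%:E \is a fin_num <-> mu.-integrable setT (EFin \o u).
Proof.
move=> mu_; rewrite -integral_fin_num_abs //; split=> [h|/integrableP[]//].
by apply/integrableP; split => //; exact/measurable_EFinP.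
Qed.

Lemma integrable_addr (u v : T -> R) : mu.-integrable setT (EFin \o u) ->
  mu.-integrable setT (EFin \o v) ->
  mu.-integrable setT (EFin \o (fun x => u x + v x)%R).
Proof. by move=> iu iv; exact (integrableD measurableT iu iv). Qed.

Lemma integrable_subr (u v : T -> R) : mu.-integrable setT (EFin \o u) ->
  mu.-integrable setT (EFin \o v) ->
  mu.-integrable setT (EFin \o (fun x => u x - v x)%R).
Proof. by move=> iu iv; exact (integrableB measurableT iu iv). Qed.

Lemma integrable_mulr (a : R) (u : T -> R) :
  mu.-integrable setT (EFin \o u) ->
  mu.-integrable setT (EFin \o (fun x => a * u x)%R).
Proof. by move=> iu; exact (integrableZl measurableT a iu). Qed.

Lemma integrable_sumr (I : Type) (r : seq I) (u : I -> T -> R) :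
  (forall i, mu.-integrable setT (EFin \o u i)) ->
  mu.-integrable setT (EFin \o (fun x => \sum_(i <- r) u i x)%R).
Proof.
move=> iu; rewrite (_ : _ \o _ = fun x => \sum_(i <- r) (EFin \o u i) x).
  exact (integrable_sum measurableT r (fun i _ => iu i)).
by apply/funext => x; rewrite sumEFin.
Qed.

(** The bounds squeeze the integral of [u] between two finite values, by a comparison that holds
    before [u] is known to be integrable. *)
Lemma ae_le_integrable (l u h : T -> R) : measurable_fun setT u ->
  mu.-integrable setT (EFin \o l) -> mu.-integrable setT (EFin \o h) ->
  {ae mu, forall x, (l x <= u x <= h x)%R} ->
  mu.-integrable setT (EFin \o u).
Proof.
move=> mu_ il ih luh.
have ml : measurable_fun setT l by exact/measurable_EFinP/measurable_int/il.
have mh : measurable_fun setT h by exact/measurable_EFinP/measurable_int/ih.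
apply/integrable_fin_numP => //; rewrite fin_numElt.
have /integrable_fin_numP -/(_ ml) := il.
have /integrable_fin_numP -/(_ mh) := ih.
rewrite !fin_numElt => /andP[_ hoo] /andP[lNoo _]; apply/andP; split.
  apply: lt_le_trans lNoo _; apply: ae_le_integral => //.
  by apply: filterS luh => x /andP[].
apply: le_lt_trans hoo; apply: ae_le_integral => //.
by apply: filterS luh => x /andP[].
Qed.

(** Scaling commutes with positive and negative parts, so the identity survives infinite and
    undefined integrals; it is applied to entropies, which may be of either kind. *)
Lemma integral_ge0Zl (a : R) (u : T -> R) : (0 <= a)%R ->
  measurable_fun setT u ->
  \int[mu]_x (a * u x)%:E = a%:E * \int[mu]_x (u x)%:E.
Proof.
rewrite le_eqVlt => /predU1P[<- _|a0 mu_].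
  by under eq_integral do rewrite mul0r; rewrite integral0 mul0e.
have meu : measurable_fun setT (EFin \o u) by exact/measurable_EFinP.
rewrite integralE [in RHS]integralE.
have -> : (fun x => (a * u x)%:E)^\+ = (fun x => a%:E * (EFin \o u)^\+ x).
  by apply/funext => x; rewrite !funeposE /= maxeMr ?lee_fin ?ltW// mule0.
have -> : (fun x => (a * u x)%:E)^\- = (fun x => a%:E * (EFin \o u)^\- x).
  apply/funext => x; rewrite !funenegE /= maxeMr ?lee_fin ?ltW// mule0.
  by rewrite -EFinM mulrN.
rewrite !ge0_integralZl ?lee_fin ?ltW//;
  [|exact: measurable_funeneg|exact: measurable_funepos].
have : 0 <= \int[mu]_x (EFin \o u)^\+ x by exact: integral_ge0.
have : 0 <= \int[mu]_x (EFin \o u)^\- x by exact: integral_ge0.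
move: (integral _ _ _) (integral _ _ _) => -[s||] [r||] //= _ _;
  rewrite ?gt0_muley ?lte_fin// -?EFinM ?addeNy ?addye//=.
- by rewrite -?EFinB -?EFinM mulrBr.
- by rewrite gt0_muleNy.
- by rewrite gt0_muleNy.
Qed.

(** An infinite negative part would give the value [-oo] whatever the positive part is. *)
Lemma integrable_funeneg_gtNy (u : T -> R) : measurable_fun setT u ->
  -oo < \int[mu]_x (u x)%:E ->
  mu.-integrable setT (EFin \o (u^\-)%R).
Proof.
move=> mu_; rewrite ltNye integralE => uNoo.
have mn : measurable_fun setT (u^\-)%R by exact: measurable_funrneg.
apply/integrable_fin_numP => //.
have -> : (fun x => (u^\- x)%R%:E) = (fun x => (u x)%:E)^\-.
  exact/esym/funerneg.
rewrite ge0_fin_numE; last by apply: integral_ge0 => x _; exact: funeneg_ge0.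
by rewrite ltey; apply/eqP => uoo; move: uNoo; rewrite uoo addeNy.
Qed.

End Integral.

(** * Change of variables between a density and its marginal *)

Section Marginal.
Context {R : realType} {d d' : measure_display}.
Context {T : measurableType d} {M : measurableType d'}.
Context {mu : {measure set T -> \bar R}} {nu : {measure set M -> \bar R}}.
Context {p : T -> M} {f : T -> R} {g : M -> R}.
Hypotheses (mp : measurable_fun setT p) (pf : prob_density mu f).
Hypothesis fg : is_marginal mu nu p f g.

Let mf : measurable_fun setT f.
Proof. by case: pf => _ /measurable_int/measurable_EFinP. Qed.

Let mg : measurable_fun setT g.
Proof. by case: fg => -[_ /measurable_int/measurable_EFinP]. Qed.

Let f0 x : 0 <= f x. Proof. by case: pf. Qed.

Let g0 t : 0 <= g t. Proof. by case: fg => -[]. Qed.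

(** The marginal is defined through bounded test functions only; truncating [phi] at height [n] and
    monotone convergence on both spaces remove the bound. *)
Lemma ge0_integral_marginal (phi : M -> R) : measurable_fun setT phi ->
  (forall t, 0 <= phi t) ->
  (\int[mu]_x (phi (p x) * f x)%:E = \int[nu]_t (phi t * g t)%:E)%E.
Proof.
move=> mphi phi0.
pose tr n (y : R) : R := Num.min y n%:R.
have truncation d1 (S : measurableType d1) (m : {measure set S -> \bar R})
    (u w : S -> R) : measurable_fun setT u -> measurable_fun setT w ->
    (forall x, 0 <= u x) -> (forall x, 0 <= w x) ->
    (\int[m]_x (u x * w x)%:E =
     limn (fun n => \int[m]_x (tr n (u x) * w x)%:E))%E.
  move=> mu_ mw u0 w0; rewrite -monotone_convergence//.
  - apply: eq_integral => x _; apply/esym/lim_near_cst => //.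
    near=> n; rewrite /tr min_l//; near: n.
    exact: nbhs_infty_ger.
  - move=> n; apply/measurable_EFinP; apply: measurable_funM => //.
    exact: measurable_minr.
  - by move=> n x _; rewrite lee_fin mulr_ge0// le_min u0/=.
  - move=> x _ n k nk; rewrite lee_fin ler_wpM2r// le_min !ge_min lexx/=.
    by rewrite ler_nat nk orbT.
rewrite truncation//; last exact: measurableT_comp mphi mp.
rewrite [RHS]truncation//; congr (limn _); apply/funext => n.
case: fg => _ /(_ (fun t => tr n (phi t))); apply; first exact: measurable_minr.
exists n%:R => t; rewrite ger0_norm; first by rewrite ge_min lexx orbT.
by rewrite le_min phi0/=.
Unshelve. all: by end_near. Qed.

(** As the weights are nonnegative, the parts of each product are the parts of [phi] times the
    weight, and [ge0_integral_marginal] applies to each. *)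
Lemma integral_marginal (phi : M -> R) : measurable_fun setT phi ->
  (\int[mu]_x (phi (p x) * f x)%:E = \int[nu]_t (phi t * g t)%:E)%E.
Proof.
move=> mphi.
have posM (S : Type) (u w : S -> R) : (forall x, 0 <= w x) ->
    (fun x => (u x * w x)%:E)^\+%E = (fun x => (u^\+ x * w x)%:E).
  move=> w0; apply/funext => x.
  by rewrite funeposE -EFin_max /funrpos maxr_pMl// mul0r.
have negM (S : Type) (u w : S -> R) : (forall x, 0 <= w x) ->
    (fun x => (u x * w x)%:E)^\-%E = (fun x => (u^\- x * w x)%:E).
  move=> w0; apply/funext => x.
  by rewrite funenegE -EFinN -EFin_max /funrneg maxr_pMl// mul0r mulNr.
rewrite integralE [RHS]integralE !posM// !negM//; congr (_ - _)%E.
- rewrite -ge0_integral_marginal//; exact: measurable_funrpos.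
- rewrite -ge0_integral_marginal//; exact: measurable_funrneg.
Qed.

(** Brings the entropies of all marginals to integrals over one space, where they can be added
    pointwise. *)
Lemma entropy_marginal :
  entropy nu g = (\int[mu]_x (ln (g (p x)) * f x)%:E)%E.
Proof.
rewrite (integral_marginal (fun t => ln (g t))).
  by apply: eq_integral => t _; rewrite mulrC.
exact: measurableT_comp mg.
Qed.

Lemma integral_marginal_indic (A : set M) : measurable A ->
  (\int[mu]_x (\1_A (p x) * f x)%:E = \int[nu]_t (\1_A t * g t)%:E)%E.
Proof. by move=> mA; apply: ge0_integral_marginal. Qed.

(** The zero set of [g] has no mass under [g dnu], so its preimage has none under [f dmu]. This
    makes [ln (g (p x))] a genuine logarithm wherever it counts. *)
Lemma density_marginal_pos : {ae mu, forall x, 0 < f x -> 0 < g (p x)}.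
Proof.
pose A := g @^-1` [set 0].
have mA : measurable A by rewrite -[A]setTI; exact: mg.
have := integral_marginal_indic _ mA.
rewrite [RHS]integral0_eq; last first.
  move=> t _; rewrite indicE; case: (boolP (t \in A)); last by rewrite mul0r.
  by rewrite inE => ->; rewrite mulr0.
move=> fA0.
have /ae_eq_integral_abs : (\int[mu]_x `|(\1_A (p x) * f x)%:E| = 0)%E.
  rewrite -[RHS]fA0; apply: eq_integral => x _.
  by rewrite gee0_abs// lee_fin mulr_ge0.
move=> /(_ measurableT) h; apply: filterS (h _) => [x /(_ I) + fx|].
  rewrite lt_neqAle g0 andbT => -[/eqP]; rewrite mulf_eq0 (gt_eqF fx) orbF.
  by rewrite indicE pnatr_eq0 eqb0 notin_setE /A/= eq_sym => /eqP.
apply/measurable_EFinP; apply: measurable_funM => //.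
exact: measurableT_comp mp.
Qed.

(** Tested against the indicator of the complement of [A], the marginal has no mass there. *)
Lemma marginal_support (A : set M) : measurable A ->
  (forall x, 0 < f x -> A (p x)) -> {ae nu, forall t, 0 < g t -> A t}.
Proof.
move=> mA fA; have mAC := measurableC mA.
have := integral_marginal_indic _ mAC.
rewrite [LHS]integral0_eq; last first.
  move=> x _; have [->|fx0] := eqVneq (f x) 0; first by rewrite mulr0.
  rewrite indicE memNset ?mul0r//=; apply.
  by apply: fA; rewrite lt_neqAle eq_sym fx0 f0.
move=> fA0.
have /ae_eq_integral_abs : (\int[nu]_t `|(\1_(~` A) t * g t)%:E| = 0)%E.
  rewrite [RHS]fA0; apply: eq_integral => x _.
  by rewrite gee0_abs// lee_fin mulr_ge0.
move=> /(_ measurableT) h; apply: filterS (h _) => [t /(_ I) + gt|].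
  move=> -[/eqP]; rewrite mulf_eq0 (gt_eqF gt) orbF.
  by rewrite indicE pnatr_eq0 eqb0 notin_setE /= => /contrapT.
by apply/measurable_EFinP; apply: measurable_funM.
Qed.

End Marginal.

(** * The entropy inequality from the multilinear one *)

Section EntropySubadditivity.
Context {R : realType}.

(* [ln s <= s - 1] at [s = b / a]. *)
Lemma gibbs_pointwise (a b : R) : 0 <= a -> 0 < b ->
  a * ln b - b + a <= a * ln a.
Proof.
rewrite le_eqVlt => /predU1P[<- b0|a0 b0].
  by rewrite !mul0r add0r addr0 oppr_le0 ltW.
have : ln (b / a) <= b / a - 1.
  have := @le_ln1Dx R (b / a - 1); rewrite [1 + _]addrC subrK; apply.
  by rewrite ltrBrDl subrr divr_gt0.
rewrite ln_div ?posrE// => /(ler_wpM2l (ltW a0)).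
by rewrite !mulrBr mulrCA divff ?gt_eqF// !mulr1; lra.
Qed.

Lemma ln_prod (I : Type) (r : seq I) (u : I -> R) : (forall i, 0 < u i) ->
  ln (\prod_(i <- r) u i) = \sum_(i <- r) ln (u i).
Proof.
move=> u0; suff [] : 0 < \prod_(i <- r) u i /\
  ln (\prod_(i <- r) u i) = \sum_(i <- r) ln (u i) by [].
elim: r => [|i r [r0 IH]]; first by rewrite !big_nil ln1.
by rewrite !big_cons mulr_gt0// lnM ?posrE// IH.
Qed.

Lemma pow_integral_ge0 d (T : measurableType d) (nu : {measure set T -> \bar R})
  (c : R) (u : T -> R) : (0 <= pow_integral nu c u)%E.
Proof.
by rewrite /pow_integral; case: ifP => _; [exact: Lnorm_ge0|exact: poweR_ge0].
Qed.

(** Normalizes the functions [g^c] to be fed into the multilinear inequality; for [c = 0] the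
    function is the constant 1, as [0^0 = 1]. *)
Lemma pow_integral_density d (T : measurableType d)
  (nu : {measure set T -> \bar R}) (c : R) (g : T -> R) :
  0 <= c -> prob_density nu g ->
  (pow_integral nu c (fun t => (g t `^ c)%R) <= 1)%E.
Proof.
move=> c0 [g0 _ g1]; rewrite /pow_integral; case: ifPn => [/eqP ->|cn0].
  rewrite unlock; case: ifPn => // _; apply/ess_supP/nearW => t /=.
  by rewrite powRr0 normr1.
under eq_integral do rewrite -powRrM mulfV// powRr1//.
by rewrite g1 poweR1r.
Qed.

Lemma prode_le1 (I : Type) (r : seq I) (u : I -> \bar R) :
  (forall i, 0 <= u i <= 1)%E -> (0 <= \prod_(i <- r) u i <= 1)%E.
Proof.
move=> u01; apply: (big_ind (fun x => 0 <= x <= 1)%E) => //.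
  by rewrite lexx lee01.
move=> x y /andP[x0 x1] /andP[y0 y1]; rewrite mule_ge0//=.
by rewrite -[leRHS]mule1 lee_pmul.
Qed.

Lemma prode_gt0 (I : Type) (r : seq I) (P : pred I) (u : I -> \bar R) :
  (forall i, P i -> 0 < u i)%E -> (0 < \prod_(i <- r | P i) u i)%E.
Proof. by move=> u0; elim/big_ind : _ => // x y; exact: mule_gt0. Qed.

Section Entropy.
Context {d : measure_display} {T : measurableType d}.
Context {mu : {measure set T -> \bar R}} {m : nat}.
Context {dM : 'I_m -> measure_display} {M : forall j, measurableType (dM j)}.
Context {nu : forall j, {measure set (M j) -> \bar R}}.
Context {p : forall j, T -> M j} {c : 'I_m -> R}.
Hypotheses (mp : forall j, measurable_fun setT (p j)) (c0 : forall j, 0 <= c j).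

Lemma measurable_prod_comp (f : forall j, M j -> R) :
  (forall j, measurable_fun setT (f j)) ->
  measurable_fun setT (fun x => \prod_(j < m) f j (p j x)).
Proof.
move=> mf; apply: measurable_prod => j _.
exact: measurableT_comp (mf j) (mp j).
Qed.

(** The last hypothesis is what the multilinear inequality gives at the powers of the marginals.
    Beyond the pointwise bound, the work lies in entropies that may be infinite or undefined: unless
    the sum is [-oo], every term is shown to be integrable. *)
Lemma entropy_subadditive (D : R) (f : T -> R) (g : forall j, M j -> R) :
  prob_density mu f -> finite_entropy mu f ->
  (forall j, is_marginal mu (nu j) (p j) f (g j)) ->
  (\int[mu]_x (\prod_(j < m) (g j (p j x) `^ c j))%R%:E <= (expR D)%:E)%E ->
  (\sum_(j < m) (c j)%:E * entropy (nu j) (g j) <= entropy mu f + D%:E)%E.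
Proof.
move=> pf fe fg FD.
have [f0 fi f1] := pf; have mf : measurable_fun setT f.
  exact/measurable_EFinP/measurable_int/fi.
have mg j : measurable_fun setT (g j).
  by have [[_ /measurable_int/measurable_EFinP]] := fg j.
pose F x := \prod_(j < m) g j (p j x) `^ c j.
have mF : measurable_fun setT F.
  apply: (measurable_prod_comp (fun j t => g j t `^ c j)) => j.
  exact: measurableT_comp (measurable_powR _) (mg j).
have F0 x : 0 <= F x by apply: prodr_ge0 => j _; exact: powR_ge0.
have iF : mu.-integrable setT (EFin \o F).
  apply/integrable_fin_numP => //; rewrite ge0_fin_numE.
    by apply: le_lt_trans FD _; rewrite ltry.
  by apply: integral_ge0 => x _; rewrite lee_fin.
pose u j x := c j * (ln (g j (p j x)) * f x).
have mlng j : measurable_fun setT (fun x => ln (g j (p j x)) * f x).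
  apply: measurable_funM => //; apply: measurableT_comp => //.
  exact: measurableT_comp (mg j) (mp j).
have mu_ j : measurable_fun setT (u j) by exact: measurable_funM.
have uE j : ((c j)%:E * entropy (nu j) (g j) = \int[mu]_x (u j x)%:E)%E.
  by rewrite (entropy_marginal (mp j) pf (fg j)) integral_ge0Zl.
under eq_bigr do rewrite uE.
(* An undefined entropy with [c j > 0] also lands in this trivial case; otherwise every [u j] has an
   integral above [-oo], hence an integrable negative part. *)
have [->|] := eqVneq (\sum_(j < m) \int[mu]_x (u j x)%:E)%E -oo%E.
  exact: leNye.
move=> /eqP uNoo.
have {}uNoo j : (-oo < \int[mu]_x (u j x)%:E)%E.
  rewrite ltNye; apply/eqP => uj; apply: uNoo; apply/esum_eqNyP.
  by exists j; split => //; exact: mem_index_enum.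
have iun j : mu.-integrable setT (EFin \o (u j)^\-).
  exact: integrable_funeneg_gtNy.
have mfln : measurable_fun setT (fun x => f x * ln (f x)).
  by apply: measurable_funM => //; exact: measurableT_comp.
(* The remainder in [gibbs_pointwise] for [a = f] and [b = e^-D F]. Its integral is at most
   [D + 1 - 1], since [f] has mass one and [F] at most [e^D]. *)
pose w x := D * f x + expR (- D) * F x - f x.
have iw : mu.-integrable setT (EFin \o w).
  by apply: integrable_subr => //; apply: integrable_addr; exact: integrable_mulr.
have mw : measurable_fun setT w by exact/measurable_EFinP/measurable_int/iw.
have wE : (\int[mu]_x (w x)%:E <= D%:E)%E.
  under eq_integral do rewrite EFinB EFinD !EFinM.
  rewrite integralB//; last by apply: integrableD => //; exact: integrableZl.
  rewrite integralD//; [|exact: integrableZl..].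
  rewrite !integralZl// f1 mule1.
  have : ((expR (- D))%:E * \int[mu]_x (F x)%:E <= 1)%E.
    apply: (@le_trans _ _ ((expR (- D))%:E * (expR D)%:E)%E).
      by rewrite lee_wpmul2l// lee_fin expR_ge0.
    by rewrite -EFinM -expRD addNr expR0.
  move=> h; apply: (@le_trans _ _ (D%:E + 1 - 1)%E).
    by rewrite leeB// leeD2l.
  by rewrite addeK.
have key : {ae mu, forall x, \sum_(j < m) u j x <= f x * ln (f x) + w x}.
  have : {ae mu, forall x, forall j, 0 < f x -> 0 < g j (p j x)}.
    apply: filter_forall => j; exact: density_marginal_pos (fg j).
  apply: filterS => x gx; rewrite /u /w.
  (* Where [f] vanishes so do all [u j], and the right side reduces to [e^-D F], which is
     nonnegative. *)
  have [fx0|fx0] := eqVneq (f x) 0.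
    rewrite fx0 !(mul0r,mulr0,add0r,subr0) big1 ?mulr_ge0 ?expR_ge0//.
    by move=> j _; rewrite !mulr0.
  have fx : 0 < f x by rewrite lt_neqAle eq_sym fx0 f0.
  have Fx : 0 < F x by apply: prodr_gt0 => j _; exact/powR_gt0/gx.
  have -> : \sum_(j < m) c j * (ln (g j (p j x)) * f x) = f x * ln (F x).
    rewrite /F ln_prod; last by move=> j; exact/powR_gt0/gx.
    by rewrite mulr_sumr; apply: eq_bigr => j _; rewrite ln_powR; ring.
  have := gibbs_pointwise _ _ (f0 x) (mulr_gt0 (expR_gt0 (- D)) Fx).
  by rewrite lnM ?posrE ?expR_gt0// expRK; lra.
have ifln1 : mu.-integrable setT (EFin \o (fun x => f x * ln (1 + f x))).
  have m1 : measurable_fun setT (fun x => f x * ln (1 + f x)).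
    apply: measurable_funM => //; apply: measurableT_comp => //.
    exact: measurable_funD.
  apply/integrable_fin_numP => //; rewrite ge0_fin_numE//.
  by apply: integral_ge0 => x _; rewrite lee_fin mulr_ge0// ln_ge0// lerDl.
have fln1 x : f x * ln (f x) <= f x * ln (1 + f x).
  have := f0 x; rewrite le_eqVlt => /predU1P[<-|fx]; first by rewrite !mul0r.
  by rewrite ler_pM2l// ler_ln ?posrE ?lerDr ?addr_gt0.
pose v x := \sum_(j < m) (u j)^\- x.
have iv : mu.-integrable setT (EFin \o v) by exact: integrable_sumr.
(* From below, [u j] is bounded by minus its negative part. From above, [key] is solved for [u j]:
   the other summands are at least minus their negative parts, and [f ln f] is at most
   [f ln (1 + f)], integrable by finite entropy. *)
have iu j : mu.-integrable setT (EFin \o u j).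
  apply: (@ae_le_integrable _ _ _ _ (fun x => -1 * (u j)^\- x) _
    (fun x => f x * ln (1 + f x) + w x + v x)) => //.
  - exact: integrable_mulr.
  - by apply: integrable_addr => //; exact: integrable_addr.
  - apply: filterS key => x; rewrite (bigD1 j)//= /v => kx; rewrite (bigD1 j)//=.
    have un i : - u i x <= (u i)^\- x by rewrite /funrneg le_max lexx.
    have un0 i : 0 <= (u i)^\- x by rewrite /funrneg le_max lexx orbT.
    have : \sum_(i < m | i != j) - u i x <= \sum_(i < m | i != j) (u i)^\- x.
      by apply: ler_sum.
    rewrite sumrN; have := un j; have := un0 j; have := fln1 x; move: kx.
    by move=> *; apply/andP; split; lra.
have iU : mu.-integrable setT (EFin \o (fun x => \sum_(j < m) u j x)).
  exact: integrable_sumr.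
rewrite -integral_sum//.
under eq_integral do rewrite sumEFin.
(* With [w] on the left, [f ln f] stands alone on the right, so monotonicity compares the integrals
   without splitting that of [f ln f + w]. *)
rewrite -leeBlDr//; apply: le_trans (_ : _ <= \int[mu]_x (\sum_(j < m) u j x - w x)%:E)%E _.
  under [leRHS]eq_integral do rewrite EFinB.
  by rewrite integralB// leeB.
apply: ae_le_integral => //.
  exact/measurable_EFinP/measurable_int/(integrable_subr _ _ iU iw).
by apply: filterS key => x; rewrite lerBlDr.
Qed.

End Entropy.
End EntropySubadditivity.

(** * Exhaustion in semifinite measures, and lower bounds for norms and entropies *)

Section LowerBounds.
Context {R : realType}.

(** Exhaustion: finite-measure subsets [B n] of [A] nearly attaining the supremum [s <= K] have a
    union of measure at most [s]. Were [A] of infinite measure, so would be the rest of [A], and a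
    piece [E] of it with finite positive measure would push some [B n] above [s]. *)
Lemma semifinite_lty d (T : measurableType d) (mu : {measure set T -> \bar R})
    (A : set T) (K : R) : semifinite mu -> measurable A ->
  (forall B, measurable B -> B `<=` A -> (mu B < +oo)%E -> (mu B <= K%:E)%E) ->
  (mu A < +oo)%E.
Proof.
move=> sf mA AK; rewrite ltey; apply/eqP => Aoo.
pose P B := [/\ measurable B, B `<=` A & (mu B < +oo)%E].
have P0 : P set0 by split => //; rewrite measure0.
have PU B C : P B -> P C -> P (B `|` C).
  move=> [mB BA Boo] [mC CA Coo]; split; [exact: measurableU|by rewrite subUset|].
  by apply: (le_lt_trans (measureU2 mu mB mC)); rewrite lte_add_pinfty.
pose s := ereal_sup [set mu B | B in P].
have sK : (s <= K%:E)%E.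
  by apply: ge_ereal_sup => _ [B [mB BA Boo] <-]; exact: AK.
have s0 : (0 <= s)%E by apply: ereal_sup_ubound; exists set0 => //; exact: measure0.
have sfin : s \is a fin_num.
  by rewrite ge0_fin_numE//; apply: le_lt_trans sK _; rewrite ltry.
have /choice[B BP] (n : nat) : exists B, P B /\ (s - (n.+1%:R^-1)%:E < mu B)%E.
  have [|_ [B PB <-] sB] := @ub_ereal_sup_adherent _ [set mu B | B in P] n.+1%:R^-1 _ sfin.
    by rewrite invr_gt0.
  by exists B.
pose C n := \big[setU/set0]_(i < n) B i.
have PC n : P (C n).
  by apply: (big_ind P) => // i _; have [] := BP i.
have mC n : measurable (C n) by have [] := PC n.
have Coo : (mu (\bigcup_n C n) <= s)%E.
  have cvgC : mu (C n) @[n --> \oo] --> mu (\bigcup_n C n).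
    apply: nondecreasing_cvg_mu => //; first exact: bigcup_measurable.
    by move=> i j ij; apply/subsetPset/subset_bigsetU.
  rewrite -(cvg_lim _ cvgC)//; apply: lime_le; first exact: cvgP cvgC.
  by apply: nearW => n; apply: ereal_sup_ubound; exists (C n).
have mUC : measurable (\bigcup_n C n) by exact: bigcup_measurable.
have [|E [mE EA /andP[E0 Eoo]]] := sf (A `\` \bigcup_n C n) (measurableD mA mUC).
  apply/eqP; rewrite -leye_eq leNgt; apply/negP => Doo; move/eqP: Aoo.
  rewrite (measureDI mu mA mUC) -leye_eq leNgt lte_add_pinfty//.
  apply: le_lt_trans (le_lt_trans Coo (le_lt_trans sK (ltry _))).
  by apply: le_measure; rewrite ?inE//; exact: measurableI.
have PE : P E by split => //; apply: subset_trans EA _; exact: subDsetl.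
have Efin : mu E \is a fin_num by rewrite ge0_fin_numE.
have small n : fine (mu E) <= n.+1%:R^-1.
  have [PB sB] := BP n; have [mB BA Boo] := PB.
  have Bfin : mu (B n) \is a fin_num by rewrite ge0_fin_numE.
  have : (mu (B n `|` E) <= s)%E.
    by apply: ereal_sup_ubound; exists (B n `|` E) => //; exact: PU.
  have -> : mu (B n `|` E) = (mu (B n) + mu E)%E.
    apply: measureU => //; rewrite -subset0 => x [Bx /EA[_]]; apply.
    (* [C n] collects the indices below [n], so [B n] enters only at [C n.+1]. *)
    by exists n.+1 => //; rewrite /C big_ord_recr/=; right.
  move: sB; rewrite -(fineK Bfin) -(fineK sfin) -(fineK Efin) -EFinB -EFinD.
  rewrite lte_fin lee_fin/= ltrBlDr => sB BEs.
  by rewrite -(lerD2l (fine (mu (B n)))) (le_trans BEs)// ltW.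
have : 0 < fine (mu E) by rewrite fine_gt0// E0.
(* For this [n], [n.+1] exceeds the inverse of [mu E], against [small]. *)
move=> E0'; have := small (Num.truncn (fine (mu E))^-1).
rewrite leNgt => /negP; apply.
by rewrite -[ltRHS]invrK ltf_pV2 ?posrE ?invr_gt0// truncnS_gt// invr_ge0 ltW.
Qed.

Lemma pow_integral_eq0 d (M : measurableType d) (nu : {measure set M -> \bar R})
    (c : R) (u : M -> R) : 0 <= c -> measurable_fun setT u ->
  (forall t, 0 <= u t) -> pow_integral nu c u = 0%E ->
  {ae nu, forall t, u t = 0}.
Proof.
move=> c0 mu_ u0; rewrite /pow_integral; case: ifPn => [_|cn0].
  move=> /Lnorm_eq0_eq0 h; have {}h := h (iffRL (measurable_EFinP _ _) mu_) (ltry 0).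
  by apply: filterS h => t /(_ I)[].
move=> /poweR_eq0_eq0 h; have {}h : (\int[nu]_t (u t `^ c^-1)%:E = 0)%E.
  by apply: h; apply: integral_ge0 => t _; rewrite lee_fin powR_ge0.
have /ae_eq_integral_abs : (\int[nu]_t `|(u t `^ c^-1)%:E| = 0)%E.
  rewrite -[RHS]h; apply: eq_integral => t _.
  by rewrite gee0_abs// lee_fin powR_ge0.
move=> /(_ measurableT) h'; apply: filterS (h' _) => [t /(_ I)[/eqP]|].
  by rewrite powR_eq0 => /andP[/eqP].
apply/measurable_EFinP; exact: measurableT_comp (measurable_powR _) mu_.
Qed.

(** If the norm vanished, [u] would vanish almost everywhere and so would [g], whose integral is
    one. Positivity gives the logarithm of the norm its meaning in [entropy_ge]. *)
Lemma pow_integral_gt0 d (M : measurableType d) (nu : {measure set M -> \bar R})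
    (c : R) (u g : M -> R) : 0 <= c -> measurable_fun setT u ->
  (forall t, 0 <= u t) -> prob_density nu g ->
  {ae nu, forall t, 0 < g t -> 0 < u t} -> (0 < pow_integral nu c u)%E.
Proof.
move=> c0 mu_ u0 [g0 gi g1] gu; rewrite lt_neqAle pow_integral_ge0 andbT eq_sym.
apply/eqP => /(pow_integral_eq0 _ _ _ _ _ c0 mu_ u0) uae.
have : (\int[nu]_t (g t)%:E <= \int[nu]_t (0%R)%:E)%E.
  apply: ae_le_integral => //; first exact/measurable_EFinP/measurable_int/gi.
  apply: filterS2 gu uae => t gut ut; rewrite leNgt; apply/negP => /gut.
  by rewrite ut ltxx.
by rewrite g1 integral0 lee_fin ler10.
Qed.

(* Pointwise, [c g ln g >= g ln u + c g - c g ln I - c u^(1/c) / I] with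
   [I = \int u^(1/c)], and the last three terms integrate to [- c ln I]. *)
Lemma entropy_ge d (M : measurableType d) (nu : {measure set M -> \bar R})
    (c : R) (u phi g : M -> R) : 0 <= c -> measurable_fun setT u ->
  (forall t, 0 <= u t) -> prob_density nu g ->
  (0 < pow_integral nu c u < +oo)%E ->
  nu.-integrable setT (EFin \o (fun t => phi t * g t)) ->
  {ae nu, forall t, 0 < g t -> 0 < u t /\ phi t = ln (u t)} ->
  (\int[nu]_t (phi t * g t)%:E - (ln (fine (pow_integral nu c u)))%:E
     <= c%:E * entropy nu g)%E.
Proof.
move=> c0 mu_ u0 [g0 gi g1] /andP[P0 Poo] iphi gphi.
have mg : measurable_fun setT g by exact/measurable_EFinP/measurable_int/gi.
have mphi := iffLR (measurable_EFinP _ _) (measurable_int _ iphi).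
have mgln : measurable_fun setT (fun t => g t * ln (g t)).
  by apply: measurable_funM => //; exact: measurableT_comp.
move: P0 Poo; rewrite /pow_integral; case: ifPn => [/eqP ->|cn0] P0 Poo.
  (* For [c = 0] the right side is [0] whatever the entropy; the claim is that the mean of [phi]
     under [g] is at most the logarithm of the essential supremum. *)
  rewrite mul0e; set N := ('N[_]_+oo[_])%E in P0 Poo *.
  have Nfin : N \is a fin_num by rewrite ge0_fin_numE// ltW.
  rewrite sube_le0.
  apply: (@le_trans _ _ (\int[nu]_t (ln (fine N) * g t)%:E)%E); last first.
    under eq_integral do rewrite EFinM.
    by rewrite integralZl// g1 mule1.
  apply: ae_le_integral => //; first exact: measurable_funM.
  have uN : {ae nu, forall t, u t <= fine N}.
    move: P0 Nfin; rewrite /N unlock; case: ifPn => [_ _ Nfin|]; last by rewrite ltxx.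
    have := ess_sup_ge nu (abse \o (EFin \o u)).
    by apply: filterS => t /=; rewrite ger0_norm// -lee_fin fineK.
  apply: filterS2 gphi uN => t gt ut.
  have [->|gn0] := eqVneq (g t) 0; first by rewrite !mulr0.
  have [ut0 ->] : 0 < u t /\ phi t = ln (u t).
    by apply: gt; rewrite lt_neqAle eq_sym gn0/=.
  by rewrite ler_wpM2r// ler_ln// posrE ?(lt_le_trans ut0).
set I := (\int[_]_t _)%E in P0 Poo *.
have I0 : (0 <= I)%E by apply: integral_ge0 => t _; rewrite lee_fin powR_ge0.
have Ifin : I \is a fin_num.
  rewrite ge0_fin_numE// ltey; apply/eqP => Ioo; move: Poo.
  by rewrite Ioo poweRyr ?ltxx.
have cpos : 0 < c by rewrite lt_neqAle eq_sym cn0.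
have Ipos : 0 < fine I.
  rewrite fine_gt0// -ge0_fin_numE// Ifin andbT lt_neqAle I0 andbT.
  by apply/eqP => I00; move: P0; rewrite -I00 poweR0r ?ltxx.
pose w t := u t `^ c^-1.
have mw : measurable_fun setT w by exact: measurableT_comp (measurable_powR _) mu_.
have iw : nu.-integrable setT (EFin \o w) by exact/integrable_fin_numP.
(* [K g - b w] collects the terms free of [phi]: as [w] has integral [I], it integrates to
   [c - c ln I - c], which is [- ln (I^c)]. *)
pose K := c - c * ln (fine I).
pose b := c / fine I.
rewrite -[in X in (_ - X)%E](fineK Ifin) poweR_EFin /= ln_powR.
rewrite -integral_ge0Zl//.
apply: (@le_trans _ _ (\int[nu]_t (phi t * g t + (K * g t - b * w t))%:E)%E).
  under [leRHS]eq_integral do rewrite EFinD EFinB.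
  rewrite integralD//; last first.
    by apply: integrable_subr; exact: integrable_mulr.
  rewrite integralB//; [|exact: integrable_mulr..].
  under [X in (_ + (X - _))%E]eq_integral do rewrite EFinM.
  under [X in (_ + (_ - X))%E]eq_integral do rewrite EFinM.
  rewrite !integralZl// g1 mule1 leeD2l// -/I -(fineK Ifin) -EFinM -EFinB.
  by rewrite lee_fin /K /b divfK ?gt_eqF// addrAC subrr add0r.
apply: ae_le_integral => //.
- apply: measurable_funD => //.
  by apply: measurable_funB => //; exact: measurable_funM.
- exact: measurable_funM.
apply: filterS gphi => t gt.
have w0 : 0 <= w t by exact: powR_ge0.
have b0 : 0 < b by exact: divr_gt0.
have [->|gn0] := eqVneq (g t) 0.
  by rewrite !(mulr0,mul0r,add0r) oppr_le0 mulr_ge0// ltW.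
have gpos : 0 < g t by rewrite lt_neqAle eq_sym gn0/=.
have [ut0 ->] := gt gpos.
have wpos : 0 < w t by exact: powR_gt0.
(* The comparison density is [w / I], proportional to [u^(1/c)]; the factor [c] then turns [ln w]
   into [ln u]. *)
have := gibbs_pointwise _ _ (g0 t) (divr_gt0 wpos Ipos).
rewrite ln_div ?posrE// ln_powR => /(ler_wpM2l c0).
have cc : c * (c^-1 * ln (u t)) = ln (u t) by rewrite mulrA divff// mul1r.
have -> : b * w t = c * (w t / fine I) by rewrite /b; ring.
suff -> : c * (g t * (c^-1 * ln (u t) - ln (fine I)) - w t / fine I + g t) =
  ln (u t) * g t + (K * g t - c * (w t / fine I)) by [].
by rewrite -{2}cc /K; ring.
Qed.

End LowerBounds.

(** * The multilinear inequality from the entropy inequality *)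

Section Duality.
Context {R : realType}.

Context {d : measure_display} {T : measurableType d}.
Context {mu : {measure set T -> \bar R}} {m : nat}.
Context {dM : 'I_m -> measure_display} {M : forall j, measurableType (dM j)}.
Context {nu : forall j, {measure set (M j) -> \bar R}}.
Context {p : forall j, T -> M j} {c : 'I_m -> R} {D : R}.
Context {marg : forall j, (T -> R) -> M j -> R}.
Hypotheses (mp : forall j, measurable_fun setT (p j)) (c0 : forall j, 0 <= c j).
Hypothesis margP : forall f : T -> R, prob_density mu f ->
  forall j, is_marginal mu (nu j) (p j) f (marg j f).
Hypothesis subadd : forall f : T -> R, prob_density mu f ->
  finite_entropy mu f ->
  (\sum_(j < m) (c j)%:E * entropy (nu j) (marg j f) <= entropy mu f + D%:E)%E.
Context {f : forall j, M j -> R}.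
Hypotheses (mf : forall j, measurable_fun setT (f j)).
Hypothesis f0 : forall j t, 0 <= f j t.

Let F x := \prod_(j < m) f j (p j x).

Let F0 x : 0 <= F x. Proof. exact: prodr_ge0. Qed.

Let mF : measurable_fun setT F. Proof. exact: measurable_prod_comp. Qed.

(** The entropy hypothesis is applied to [F] restricted to [B] and normalized, which has finite
    entropy since [F] is bounded on a set of finite measure. The bound is the same for all [n] and
    [B], ready for exhaustion. *)
Lemma integral_level_le (n : nat) (B : set T) : measurable B ->
  (mu B < +oo)%E ->
  (forall x, B x -> forall j, n.+1%:R^-1 <= f j (p j x) <= n.+1%:R) ->
  (\int[mu]_x (F x * \1_B x)%:E <=
    (expR D)%:E * \prod_(j < m) pow_integral (nu j) (c j) (f j))%E.
Proof.
move=> mB Boo BN; set N : R := n.+1%:R in BN.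
have N0 : 0 < N by rewrite ltr0n.
have N1 : 1 <= N by rewrite ler1n.
have iB (a : R) : mu.-integrable setT (EFin \o (fun x => a * \1_B x)).
  apply: integrable_mulr; apply/integrable_fin_numP => //.
  by rewrite integral_indic// setIT ge0_fin_numE.
pose h x := F x * \1_B x.
have h0 x : 0 <= h x by rewrite mulr_ge0.
have mh : measurable_fun setT h by exact: measurable_funM.
have hN x : h x <= N ^+ m * \1_B x.
  rewrite /h indicE; case: (boolP (x \in B)); last by rewrite !mulr0.
  rewrite inE !mulr1 => /BN xN; rewrite -[leRHS]mulr1.
  rewrite (_ : N ^+ m * 1 = \prod_(j < m) N); last first.
    by rewrite prodr_const card_ord mulr1.
  by apply: ler_prod => j _; rewrite f0/=; case/andP: (xN j).
have ih : mu.-integrable setT (EFin \o h).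
  apply: (@ae_le_integrable _ _ _ _ (fun x => 0 * \1_B x) _
    (fun x => N ^+ m * \1_B x)) => //.
  by apply: aeW => x; rewrite mul0r h0 hN.
have hfin := iffRL (integrable_fin_numP _ mh) ih.
have hge0 : (0 <= \int[mu]_x (h x)%:E)%E.
  by apply: integral_ge0 => x _; rewrite lee_fin.
have Pge0 j : (0 <= pow_integral (nu j) (c j) (f j))%E.
  exact: pow_integral_ge0.
have [->|Zn0] := eqVneq (\int[mu]_x (h x)%:E)%E 0%E.
  by rewrite mule_ge0 ?prode_ge0// lee_fin expR_ge0.
pose Z := fine (\int[mu]_x (h x)%:E).
have ZE : (\int[mu]_x (h x)%:E)%E = Z%:E by rewrite fineK.
have Z0 : 0 < Z by rewrite -lte_fin -ZE lt_neqAle eq_sym Zn0.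
pose w x := Z^-1 * h x.
have w0 x : 0 <= w x by rewrite mulr_ge0// invr_ge0 ltW.
have mw : measurable_fun setT w by exact: measurable_funM.
have iw : mu.-integrable setT (EFin \o w) by exact: integrable_mulr.
have w1 : (\int[mu]_x (w x)%:E = 1)%E.
  rewrite integral_ge0Zl ?invr_ge0 ?ltW// ZE -EFinM mulVf//.
  by rewrite gt_eqF.
have pw : prob_density mu w by [].
have wB x : 0 < w x -> B x.
  rewrite /w /h indicE; case: (boolP (x \in B)); first by rewrite inE.
  by rewrite !mulr0 ltxx.
have wE x : B x -> w x = Z^-1 * F x.
  by move=> Bx; rewrite /w /h indicE mem_set// mulr1.
have few : finite_entropy mu w.
  (* [L] bounds [w], and [s ln (1 + s)] is increasing, so a multiple of the indicator of [B]
     dominates the integrand. *)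
  pose L := Z^-1 * N ^+ m.
  have iL := iB (L * ln (1 + L)).
  have mL := iffLR (measurable_EFinP _ _) (measurable_int _ iL).
  have := iffRL (integrable_fin_numP _ mL) iL.
  rewrite fin_numElt => /andP[_]; apply: le_lt_trans.
  apply: ae_le_integral => //.
    apply: measurable_funM => //; apply: measurableT_comp => //.
    exact: measurable_funD.
  apply: aeW => x; have [wx0|wxn0] := eqVneq (w x) 0.
    rewrite wx0 mul0r mulr_ge0// mulr_ge0 ?ln_ge0 ?lerDl//.
      by rewrite mulr_ge0 ?invr_ge0 ?exprn_ge0// ltW.
    by rewrite mulr_ge0 ?invr_ge0 ?exprn_ge0// ltW.
  have wx : 0 < w x by rewrite lt_neqAle eq_sym wxn0/=.
  have wL : w x <= L.
    rewrite ler_pM2l ?invr_gt0// (le_trans (hN x))//.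
    by rewrite indicE mem_set ?mulr1//; exact: wB.
  rewrite indicE mem_set ?mulr1; last exact: wB.
  rewrite ler_pM ?ln_ge0 ?lerDl// ler_ln ?posrE ?lerD2l//.
    by rewrite addr_gt0.
  by rewrite addr_gt0// (lt_le_trans wx).
pose g j := marg j w.
have wg j : is_marginal mu (nu j) (p j) w (g j) by exact: margP.
have pg j : prob_density (nu j) (g j) by case: (wg j).
have g0 j t : 0 <= g j t by case: (pg j).
(* A bounded substitute for [ln (f j t)]: clipping [f j] to [[1/N, N]] makes it integrable against
   [g j] and changes nothing at points [p j x] with [x] in [B]. *)
pose phi j t := ln (Num.min N (Num.max N^-1 (f j t))).
have mphi j : measurable_fun setT (phi j).
  apply: measurableT_comp => //; apply: measurable_minr => //.
  exact: measurable_maxr.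
have phiE j t : N^-1 <= f j t <= N -> phi j t = ln (f j t).
  by move=> /andP[Nf fN]; rewrite /phi max_r// min_r.
have phiN j t : - ln N <= phi j t <= ln N.
  have NV0 : 0 < N^-1 by rewrite invr_gt0.
  have pos : 0 < Num.min N (Num.max N^-1 (f j t)).
    by rewrite lt_min N0 lt_max NV0.
  rewrite /phi -lnV ?posrE// !ler_ln ?posrE// ge_min lexx/= andbT.
  by rewrite le_min le_max lexx/= andbT (le_trans _ N1)// invf_le1.
have iphi j : (nu j).-integrable setT (EFin \o (fun t => phi j t * g j t)).
  have [_ ig _] := pg j.
  have mg : measurable_fun setT (g j) by exact/measurable_EFinP/measurable_int/ig.
  apply: (@ae_le_integrable _ _ _ _ (fun t => - ln N * g j t) _
    (fun t => ln N * g j t)); [exact: measurable_funM|exact: integrable_mulr..|].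
  by apply: aeW => t; case/andP: (phiN j t) => *; rewrite !ler_wpM2r.
have phi_marg j : (\int[mu]_x (phi j (p j x) * w x)%:E =
    \int[nu j]_t (phi j t * g j t)%:E)%E by exact: integral_marginal.
have mphig j : measurable_fun setT (fun t => phi j t * g j t).
  exact/measurable_EFinP/measurable_int/(iphi j).
have phifin j := iffRL (integrable_fin_numP _ (mphig j)) (iphi j).
have mphiw j : measurable_fun setT (fun x => phi j (p j x) * w x).
  by apply: measurable_funM => //; exact: measurableT_comp (mp j).
have iphiw j : mu.-integrable setT (EFin \o (fun x => phi j (p j x) * w x)).
  by apply/integrable_fin_numP => //; rewrite phi_marg.
pose a j := fine (\int[nu j]_t (phi j t * g j t)%:E).
have aE j : (\int[nu j]_t (phi j t * g j t)%:E)%E = (a j)%:E by rewrite fineK.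
(* [w] lives on [B], whose image under [p j] lies in this level set. *)
have gB j : {ae nu j, forall t, 0 < g j t -> N^-1 <= f j t <= N}.
  apply: (marginal_support (mp j) pw (wg j) [set t | N^-1 <= f j t <= N]).
    have -> : [set t | N^-1 <= f j t <= N] = f j @^-1` `[N^-1, N].
      by apply/seteqP; split=> t /=; rewrite in_itv.
    by rewrite -[X in measurable X]setTI; exact: mf.
  by move=> x /wB Bx; exact: BN.
have gf j : {ae nu j, forall t, 0 < g j t -> 0 < f j t /\ phi j t = ln (f j t)}.
  apply: filterS (gB j) => t gN /gN fN; split; last exact: phiE.
  by case/andP: fN => + _; apply: lt_le_trans; rewrite invr_gt0.
have P0 j : (0 < pow_integral (nu j) (c j) (f j))%E.
  apply: pow_integral_gt0 (pg j) _ => //.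
  by apply: filterS (gf j) => t gft /gft[].
(* As all norms are positive, a single infinite one makes the right side [+oo]; from then on all of
   them are real. *)
have [[j Poo]|Poo] := pselect (exists j, pow_integral (nu j) (c j) (f j) = +oo%E).
  rewrite (bigD1 j)//= Poo gt0_mulye ?gt0_muley ?leey// ?lte_fin ?expR_gt0//.
  exact: prode_gt0.
have {}Poo j : (pow_integral (nu j) (c j) (f j) < +oo)%E.
  by rewrite ltey; apply/eqP => h'; apply: Poo; exists j.
pose q j := fine (pow_integral (nu j) (c j) (f j)).
have qE j : pow_integral (nu j) (c j) (f j) = (q j)%:E.
  by rewrite fineK// ge0_fin_numE.
have q0 j : 0 < q j by rewrite -lte_fin -qE.
have lower j : ((a j - ln (q j))%:E <= (c j)%:E * entropy (nu j) (g j))%E.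
  rewrite EFinB -aE; apply: entropy_ge (iphi j) (gf j) => //.
  by rewrite P0 Poo.
(* On the support of [w], [ln w] is the sum of the [ln f_j] minus [ln Z]; the marginals turn each
   summand into [a j], and [w] has mass one. *)
have entropyw : entropy mu w = (\sum_(j < m) a j - ln Z)%:E.
  rewrite /entropy (_ : (fun x => (w x * ln (w x))%:E) = (fun x =>
      (\sum_(j < m) phi j (p j x) * w x)%:E - (ln Z * w x)%:E)%E); last first.
    apply/funext => x; rewrite -EFinB; congr EFin.
    have [wx0|wxn0] := eqVneq (w x) 0.
      rewrite wx0 !(mulr0,mul0r) big1 ?subr0// => j _.
      by rewrite mulr0.
    have wx : 0 < w x by rewrite lt_neqAle eq_sym wxn0/=.
    have Bx := wB _ wx; rewrite -mulr_suml -mulrBl mulrC; congr (_ * _).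
    have fx j : 0 < f j (p j x).
      by case/andP: (BN _ Bx j) => + _; apply: lt_le_trans; rewrite invr_gt0.
    rewrite wE// lnM ?posrE ?invr_gt0 ?prodr_gt0// lnV ?posrE// addrC.
    by congr (_ - _); rewrite ln_prod//; apply: eq_bigr => j _; rewrite phiE// BN.
  rewrite integralB//; [|exact: integrable_sumr|exact: integrable_mulr].
  under eq_integral do rewrite -sumEFin.
  rewrite integral_sum//.
  under eq_bigr do rewrite phi_marg aE.
  under [X in (_ - X)%E]eq_integral do rewrite EFinM.
  by rewrite integralZl// w1 mule1 sumEFin -EFinB.
(* The [a j] occur on both sides and cancel, leaving [ln Z <= D + \sum_j ln (q j)]. *)
have : (\sum_(j < m) (a j - ln (q j))%:E <= entropy mu w + D%:E)%E.
  by apply: (le_trans _ (subadd _ pw few)); apply: lee_sum.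
rewrite entropyw -EFinD sumEFin lee_fin sumrB => ineq.
rewrite ZE; under eq_bigr do rewrite qE.
rewrite prodEFin -EFinM lee_fin.
rewrite -ler_ln ?posrE ?mulr_gt0 ?expR_gt0 ?prodr_gt0//.
rewrite lnM ?posrE ?expR_gt0 ?prodr_gt0// expRK ln_prod//.
by lra.
Qed.

(** The level sets [A n] exhaust the points where [F] is positive, so the uniform bound of
    [integral_level_le] passes to the limit once each [A n] has finite measure, which is where
    semifiniteness enters. *)
Lemma integral_prod_le : semifinite mu ->
  (\int[mu]_x (F x)%:E <=
    (expR D)%:E * \prod_(j < m) pow_integral (nu j) (c j) (f j))%E.
Proof.
move=> sf; set K := (X in (_ <= X)%E).
have K0 : (0 <= K)%E.
  rewrite mule_ge0 ?lee_fin ?expR_ge0// prode_ge0// => j _.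
  exact: pow_integral_ge0.
have [->|Koo] := eqVneq K +oo%E; first exact: leey.
have Kfin : K \is a fin_num by rewrite ge0_fin_numE// ltey.
pose A n := \bigcap_(j in [set: 'I_m])
  [set x | n.+1%:R^-1 <= f j (p j x) <= n.+1%:R].
have mA n : measurable (A n).
  apply: fin_bigcap_measurable => // j _.
  have -> : [set x | n.+1%:R^-1 <= f j (p j x) <= n.+1%:R] =
      (f j \o p j) @^-1` `[n.+1%:R^-1, n.+1%:R].
    by apply/seteqP; split=> t /=; rewrite in_itv.
  rewrite -[X in measurable X]setTI.
  exact: (measurableT_comp (mf j) (mp j)).
have Aoo n : (mu (A n) < +oo)%E.
  apply: (@semifinite_lty _ _ _ _ _ (n.+1%:R ^+ m * fine K) sf (mA n)).
  move=> B mB BA Boo.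
  have Bfin : mu B \is a fin_num by rewrite ge0_fin_numE.
  (* Chebyshev's inequality: [F] is at least [(n+1)^-m] on [B], so [mu B] is at most [(n+1)^m K] for
     every [B] of finite measure inside [A n]. *)
  have BF : ((n.+1%:R^-1 ^+ m)%:E * mu B <= \int[mu]_x (F x * \1_B x)%:E)%E.
    rewrite -[in mu B](setIT B) -integral_indic// -integral_ge0Zl//.
    apply: ae_le_integral; [exact: measurable_funM..|].
    apply: aeW => x; rewrite indicE; case: (boolP (x \in B)) => xB; last first.
      by rewrite !mulr0.
    rewrite !mulr1 (_ : _ ^+ m = \prod_(j < m) n.+1%:R^-1); last first.
      by rewrite prodr_const card_ord.
    apply: ler_prod => j _; rewrite invr_ge0 ler0n/=.
    by move: xB; rewrite inE => /BA /(_ j I) /andP[].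
  have /(le_trans BF) : (\int[mu]_x (F x * \1_B x)%:E <= K)%E.
    by apply: (@integral_level_le n) => // x /BA Ax j; exact: Ax.
  rewrite -(fineK Bfin) -(fineK Kfin) -EFinM !lee_fin/= exprVn.
  by rewrite mulrC ler_pdivrMr ?exprn_gt0// mulrC.
have FA n : (\int[mu]_x (F x * \1_(A n) x)%:E <= K)%E.
  by apply: (@integral_level_le n) => // x Ax j; exact: Ax.
have AF x : limn (fun n => (F x * \1_(A n) x)%:E) = (F x)%:E.
  apply/lim_near_cst => //.
  have [Fx0|Fxn0] := eqVneq (F x) 0; first by near=> n; rewrite Fx0 mul0r.
  have fx j : 0 < f j (p j x).
    rewrite lt_neqAle f0 andbT eq_sym; apply: contraNN Fxn0 => /eqP fj0.
    by rewrite /F (bigD1 j)//= fj0 mul0r.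
  (* Finitely many positive numbers all lie in [[1/(n+1), n+1]] for large [n]. *)
  have Ax : \forall n \near \oo,
      forall j, n.+1%:R^-1 <= f j (p j x) <= n.+1%:R.
    apply: filter_forall => j; near=> n.
    have n0 : 0 < n.+1%:R :> R by rewrite ltr0n.
    have n1 : n%:R <= n.+1%:R :> R by rewrite ler_nat.
    apply/andP; split.
      rewrite -[leRHS]invrK lef_pV2 ?posrE ?invr_gt0//.
      by apply: le_trans n1; near: n; exact: nbhs_infty_ger.
    by apply: le_trans n1; near: n; exact: nbhs_infty_ger.
  by apply: filterS Ax => n Ax; rewrite indicE mem_set ?mulr1// => j _; exact: Ax.
have cvgF : (\int[mu]_x (F x * \1_(A n) x)%:E)%E @[n --> \oo] -->
    (\int[mu]_x (F x)%:E)%E.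
  under [X in _ --> X]eq_integral do rewrite -AF.
  apply: cvg_monotone_convergence => //.
  - by move=> n; apply/measurable_EFinP; exact: measurable_funM.
  - by move=> n x _; rewrite lee_fin mulr_ge0.
  - move=> x _ i j ij; rewrite lee_fin ler_wpM2l// !indicE ler_nat.
    case: (boolP (x \in A i)) => //; rewrite inE => Ax; rewrite mem_set// => k kT.
    have ijR : i.+1%:R <= j.+1%:R :> R by rewrite ler_nat.
    have /andP[lo up] := Ax k kT; apply/andP; split; last exact: le_trans ijR.
    by apply: le_trans lo; rewrite lef_pV2 ?posrE.
rewrite -(cvg_lim _ cvgF)//; apply: lime_le; first exact: cvgP cvgF.
exact: nearW.
Unshelve. all: by end_near. Qed.

End Duality.

(** * Equivalence of the two inequalities *)

Theorem theorem2p1 (R : realType)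
  (d : measure_display) (Omega : measurableType d)
  (mu : {measure set Omega -> \bar R}) (Hmu : semifinite mu)
  (m : nat) (Hm : (1 <= m)%N)
  (dM : 'I_m -> measure_display) (M : forall j, measurableType (dM j))
  (nu : forall j, {measure set (M j) -> \bar R})
  (p : forall j, Omega -> M j) (Hp : forall j, measurable_fun setT (p j))
  (marg : forall j, (Omega -> R) -> M j -> R)
  (Hmarg : forall f : Omega -> R, prob_density mu f ->
     forall j, is_marginal mu (nu j) (p j) f (marg j f))
  (c : 'I_m -> R) (Hc : forall j, 0 <= c j)
  (D : R) :
  (forall f : forall j, M j -> R,
     (forall j, measurable_fun setT (f j)) ->
     (forall j t, 0 <= f j t) ->
     (\int[mu]_x (\prod_(j < m) f j (p j x))%R%:E
       <= (expR D)%:E * \prod_(j < m) pow_integral (nu j) (c j) (f j))%E)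
  <->
  (forall f : Omega -> R, prob_density mu f -> finite_entropy mu f ->
     (\sum_(j < m) (c j)%:E * entropy (nu j) (marg j f)
       <= entropy mu f + D%:E)%E).
Proof.
split=> [BL f pf fe|subadd f mf f0]; last first.
  exact: (integral_prod_le Hp Hc Hmarg subadd mf f0 Hmu).
apply: (entropy_subadditive Hp Hc _ _ _ pf fe (Hmarg f pf)).
have pg j : prob_density (nu j) (marg j f) by case: (Hmarg f pf j).
(* For the powers [g_j^(c_j)] of the marginals, the norms on the right are at most one, which leaves
   [e^D]. *)
apply: le_trans (BL (fun j t => marg j f t `^ c j) _ _) _.
- move=> j; have [_ /measurable_int/measurable_EFinP mg _] := pg j.
  exact: measurableT_comp (measurable_powR _) mg.
- by move=> j t; exact: powR_ge0.
rewrite -[leRHS]mule1 lee_wpmul2l ?lee_fin ?expR_ge0//.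
have : (0 <= \prod_(j < m)
    pow_integral (nu j) (c j) (fun t => (marg j f t `^ c j)%R) <= 1)%E.
  by apply: prode_le1 => j; rewrite pow_integral_ge0 pow_integral_density.
by case/andP.
Qed.
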